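(* Let $d\ge1$ be an integer and let $V:\mathbb{Z}^d\to\mathbb{R}$ have a smooth extension $\widetilde V:\mathbb{R}^d\to\mathbb{R}$ such that, for some $0<\theta\le1$, for every multi-index $\alpha\in\mathbb{Z}^d_{\ge0}$ there is a constant $C_\alpha$ with $$|\partial^\alpha\widetilde V(x)|\le C_\alpha(1+|x|)^{-\theta|\alpha|}\quad\text{for all }x\in\mathbb{R}^d,$$ and $\liminf_{|x|\to\infty}\widetilde V(x)\ge0$. Let $E<0$. If $u\in\ell^2(\mathbb{Z}^d)$ and $(H-E)u=0$, then for any $\varepsilon>0$ there exists $C_\varepsilon>0$ such that $$|u(x)|\le C_\varepsilon e^{-(1-\varepsilon)\rho_E(x)}\quad\text{for any }x\in\mathbb{Z}^d.$$
   Context: $H$ is the discrete Schrödinger operator on $\ell^2(\mathbb{Z}^d)$ (complex-valued functions) defined by $$Hu(x)=-\sum_{y\in\mathbb{Z}^d,\ |x-y|=1}(u(y)-u(x))+V(x)u(x),\qquad x\in\mathbb{Z}^d .$$ Set $q(\xi)=4\sum_{j=1}^d\sinh^2\frac{\xi_j}{2}$, $K^E=\{\xi\in\mathbb{R}^d\mid q(\xi)\le|E|\}$ and $\rho_E(x)=\sup_{\xi\in K^E}\langle x,\xi\rangle$ for $x\in\mathbb{R}^d$. *)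

(* Defs.v *)
From mathcomp Require Export all_boot all_order all_algebra.
From mathcomp Require Export all_classical all_reals all_analysis.
From mathcomp Require Export complex.

Set Implicit Arguments.
Unset Strict Implicit.
Unset Printing Implicit Defensive.

Import Order.TTheory GRing.Theory Num.Theory.
Import numFieldNormedType.Exports.

Local Open Scope classical_set_scope.
Local Open Scope ring_scope.
Local Open Scope complex_scope.

Section Euclidean.
Context {R : realType} {d : nat}.

Definition dotv (x y : 'rV[R]_d) : R := \sum_(j < d) x 0 j * y 0 j.

(* The library norm `|x| on row vectors is the sup norm; nearest neighbours in
   Z^d have to be taken for the Euclidean one. *)
Definition enorm (x : 'rV[R]_d) : R := Num.sqrt (dotv x x).

Definition latv (x : 'rV[int]_d) : 'rV[R]_d := map_mx intr x.

(* The filter |x| --> +oo on R^d. *)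
Definition at_infinity : set_system 'rV[R]_d :=
  filter_from [set: R] (fun M => [set x | M < enorm x]).

Definition partial (i : 'I_d) (f : 'rV[R]_d -> R) : 'rV[R]_d -> R :=
  fun x => 'D_(delta_mx 0 i) f x.

Definition partials (s : seq 'I_d) (f : 'rV[R]_d -> R) : 'rV[R]_d -> R :=
  foldr partial f s.

(* 'D_v f x is a default value where the directional derivative does not exist,
   hence the explicit derivability clause. *)
Definition smooth (f : 'rV[R]_d -> R) : Prop :=
  forall s : seq 'I_d, continuous (partials s f) /\
    forall (i : 'I_d) (x : 'rV[R]_d), derivable (partials s f) x (delta_mx 0 i).

Definition mpartial (a : 'I_d -> nat) (f : 'rV[R]_d -> R) : 'rV[R]_d -> R :=
  foldr (fun i g => iter (a i) (partial i) g) f (enum 'I_d).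

Definition mlength (a : 'I_d -> nat) : nat := (\sum_(i < d) a i)%N.

End Euclidean.

Section Schrodinger.
Context {R : realType} {d : nat}.

Definition in_l2 (u : 'rV[int]_d -> R[i]) : Prop :=
  summable [set: 'rV[int]_d] (fun x => (Normc.normc (u x) ^+ 2)%:E).

Definition neighbours (x : 'rV[int]_d) : set 'rV[int]_d :=
  [set y | enorm (latv (x - y) : 'rV[R]_d) = 1].

Definition schrodinger (V : 'rV[int]_d -> R) (u : 'rV[int]_d -> R[i]) :
    'rV[int]_d -> R[i] :=
  fun x => - (\sum_(y \in neighbours x) (u y - u x)) + (V x)%:C * u x.

Definition sinh (t : R) : R := (expR t - expR (- t)) / 2.

Definition qsymb (xi : 'rV[R]_d) : R :=
  4 * \sum_(j < d) sinh (xi 0 j / 2) ^+ 2.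

Definition KE (E : R) : set 'rV[R]_d := [set xi | qsymb xi <= `|E|].

Definition rhoE (E : R) (x : 'rV[R]_d) : R := sup [set dotv x xi | xi in KE E].

End Schrodinger.

(* Main.v *)
(* Each exponential e^{-<x,eta>} satisfies
   sum_{|y-x|=1} e^{-<y,eta>} = (2d + q(eta)) e^{-<x,eta>}.
   If q(eta) < |E|, it is therefore a strict supersolution of H - E wherever V
   is close to being nonnegative, that is, outside a large ball, while |u| is a
   subsolution there because V is real.  A maximum principle on Z^d, valid for
   bounded u, compares |u| with a multiple of e^{-<x,eta>}, and this multiple is
   uniform over eta = t xi with xi in K^E, a bounded set.  By convexity of q,
   q(t xi) <= t q(xi) <= t |E| < |E| when t < 1, and the infimum over xi of the
   exponentials is e^{-t rho_E(x)}. *)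
Require Import Defs.
From mathcomp Require Import ring lra zify.
Import Order.TTheory GRing.Theory Num.Theory.
Import numFieldNormedType.Exports.
Local Open Scope classical_set_scope.
Local Open Scope ring_scope.
Local Open Scope complex_scope.

(* The supremum S of w+ satisfies S <= #|K| / (#|K| + c) * S. *)
Lemma bounded_maximum_principle (R : realType) (T : Type) (K : finType)
    (nb : T -> K -> T) (w : T -> R) (c M : R) :
    0 < c -> (forall x, w x <= M) ->
    (forall x, 0 < w x -> (#|K|%:R + c) * w x <= \sum_k w (nb x k)) ->
  forall x, w x <= 0.
Proof.
move=> c0 wM sub x0; rewrite leNgt; apply/negP => w0.
have hs : has_ubound (range w) by exists M => _ [x _ <-].
set S := sup (range w).
have wS x : w x <= S by apply: ub_le_sup => //; exists x.
have S0 : 0 < S := lt_le_trans w0 (wS x0).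
have N0 : 0 <= #|K|%:R :> R by rewrite ler0n.
have : S <= #|K|%:R * S / (#|K|%:R + c).
  apply: ge_sup; first by exists (w x0), x0.
  move=> _ [x _ <-]; rewrite ler_pdivlMr; last by lra.
  have [wx|wx] := ltP 0 (w x); last first.
    apply: (@le_trans _ _ 0); last by rewrite mulr_ge0// ltW.
    by rewrite mulr_le0_ge0//; lra.
  rewrite mulrC (le_trans (sub _ wx))//.
  apply: (@le_trans _ _ (\sum_(k : K) S)); first exact: ler_sum.
  by rewrite sumr_const mulr_natl.
rewrite ler_pdivlMr; last by lra.
by have := mulr_gt0 c0 S0; nra.
Qed.

(** * Nearest neighbours in the lattice *)

Section Lattice.
Context {R : realType} {d : nat}.
Implicit Types (x y : 'rV[int]_d) (xi eta : 'rV[R]_d).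

(** A pair is an axis and a sign, [true] meaning minus; this finite type indexes the 2d unit
    steps. *)
Definition step (k : 'I_d * bool) : 'rV[int]_d := (-1) ^+ k.2 *: delta_mx 0 k.1.

Lemma stepE (k : 'I_d * bool) (j : 'I_d) :
  step k 0 j = (-1) ^+ k.2 * (j == k.1)%:R.
Proof. by rewrite !mxE eqxx. Qed.

Lemma step_inj : injective step.
Proof.
move=> [i a] [j b] /rowP e; move: (e i); rewrite !stepE/= eqxx.
case: eqVneq => [<-|_]; first by move: a b {e} => [] [].
by move: a b {e} => [] [].
Qed.

(** By integrality a nonzero coordinate contributes at least 1 to the sum, so it is 1 or -1 and all
    others vanish. *)
Lemma sum_sqr_eq1 (z : 'rV[int]_d) :
  \sum_j z 0 j * z 0 j = 1 -> exists k, z = step k.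
Proof.
move=> z1.
have [j zj] : exists j, z 0 j != 0.
  apply: contrapT => /forallNP z0; move: z1; rewrite big1// => j _.
  by have /negP := z0 j; rewrite negbK => /eqP ->; rewrite mulr0.
move: z1; rewrite (bigD1 j)//= => z1.
have rest0 : 0 <= \sum_(i < d | i != j) z 0 i * z 0 i.
  by apply: sumr_ge0 => i _; rewrite -expr2 sqr_ge0.
have zj1 : z 0 j * z 0 j = 1.
  by move: (z 0 j) (\sum_(i | _) _) zj rest0 z1 => a r a0 r0 ar; nia.
have {}rest0 : \sum_(i < d | i != j) z 0 i * z 0 i = 0.
  by apply: (addrI 1); rewrite -[in LHS]zj1 z1 addr0.
exists (j, z 0 j < 0); apply/rowP => i; rewrite stepE/=.
have [->|ij] := eqVneq i j.
  by have [|] := ltP (z 0 j) 0; rewrite ?expr0 ?expr1 mulr1; nia.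
have sq0 k : k != j -> 0 <= z 0 k * z 0 k by rewrite -expr2 sqr_ge0.
have /eqP := psumr_eq0P sq0 rest0 ij.
by rewrite mulf_eq0 orbb mulr0 => /eqP.
Qed.

Lemma dotv_latv (x : 'rV[int]_d) :
  dotv (latv x) (latv x) = (\sum_j x 0 j * x 0 j)%:~R :> R.
Proof.
by rewrite rmorph_sum; apply: eq_bigr => j _; rewrite !mxE rmorphM.
Qed.

Lemma neighboursP x y :
  neighbours (R := R) x y <-> exists k, y = x + step k.
Proof.
rewrite /neighbours/= /enorm dotv_latv; split.
  move=> /(congr1 (fun t : R => t ^+ 2)); rewrite sqr_sqrtr; last first.
    by rewrite ler0z; apply: sumr_ge0 => i _; rewrite -expr2 sqr_ge0.
  rewrite expr1n => /eqP; rewrite -[1]/(1%:~R) eqr_int => /eqP/sum_sqr_eq1.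
  (* The sign flips: [xy] describes x - y, while the witness describes y - x. *)
  move=> [[j b] xy]; exists (j, ~~ b).
  rewrite -[y](subKr x) xy; congr (_ + _).
  by rewrite /step/= -scaleNr; case: b {xy}; rewrite ?opprK.
move=> [[j b] ->].
rewrite (bigD1 j)//= big1 ?addr0; last first.
  by move=> i ij; rewrite opprD addNKr !mxE eqxx (negPf ij)/= mulr0 oppr0 mulr0.
rewrite opprD addNKr !mxE !eqxx/= mulr1 mulrNN.
by case: b; rewrite ?expr1 ?expr0 ?mulrNN mulr1 sqrtr1.
Qed.

Lemma sum_neighbours (W : nmodType) (f : 'rV[int]_d -> W) x :
  \sum_(y \in neighbours (R := R) x) f y = \sum_k f (x + step k).
Proof.
have nbE : neighbours (R := R) x = [set` [seq x + step k | k : 'I_d * bool]].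
  apply/seteqP; split => y /=.
    by move=> /neighboursP[k ->]; apply/mapP; exists k; rewrite ?mem_enum.
  by move=> /mapP[k _ ->]; apply/neighboursP; exists k.
rewrite nbE -fsbig_seq ?big_image//.
by rewrite map_inj_uniq ?enum_uniq// => k l /addrI /step_inj.
Qed.

Lemma dotv_latvD x y xi :
  dotv (latv (x + y)) xi = dotv (latv x) xi + dotv (latv y) xi.
Proof.
rewrite /dotv -big_split; apply: eq_bigr => j _ /=.
by rewrite !mxE rmorphD mulrDl.
Qed.

Lemma dotv_latv_step k xi :
  dotv (latv (step k)) xi = (-1) ^+ k.2 * xi 0 k.1.
Proof.
rewrite /dotv (bigD1 k.1)//= big1 ?addr0; last first.
  by move=> i ik; rewrite !mxE eqxx (negPf ik)/= mulr0 mul0r.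
by rewrite !mxE !eqxx/= mulr1 rmorphXn rmorphN.
Qed.

Lemma dotvZr (t : R) xi eta : dotv xi (t *: eta) = t * dotv xi eta.
Proof.
by rewrite /dotv mulr_sumr; apply: eq_bigr => j _; rewrite !mxE mulrCA.
Qed.

(** * The symbol q and the set K^E *)

Lemma qsymbE xi :
  qsymb xi = \sum_j (expR (xi 0 j) + expR (- xi 0 j) - 2).
Proof.
rewrite /qsymb mulr_sumr; apply: eq_bigr => j _; rewrite /sinh.
set s := xi 0 j / 2.
have -> : xi 0 j = s + s by rewrite /s; field.
rewrite opprD !expRD.
have := expRxMexpNx_1 s; move: (expR s) (expR (- s)) => a b ab.
have -> : 4 * ((a - b) / 2) ^+ 2 = a * a + b * b - 2 * (a * b) by field.
by rewrite ab mulr1.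
Qed.

Lemma qsymb_ge0 xi : 0 <= qsymb xi.
Proof. by rewrite mulr_ge0// sumr_ge0// => j _; exact: sqr_ge0. Qed.

(** Convexity of exp between 0 and a: the tangent at b = ta bounds exp from below at a and at 0, and
    with weights t and 1 - t the linear terms cancel. *)
Lemma expR_chord (t a : R) : 0 <= t <= 1 ->
  expR (t * a) <= t * expR a + (1 - t).
Proof.
move=> /andP[t0 t1]; set b := t * a.
have ha : expR b * (1 + (a - b)) <= expR a.
  have -> : expR a = expR b * expR (a - b) by rewrite -expRD addrC subrK.
  by rewrite ler_pM2l ?expR_gt0// expR_ge1Dx.
have h1 : expR b * (1 - b) <= 1.
  by rewrite -[leRHS](expRxMexpNx_1 b) ler_pM2l ?expR_gt0// expR_ge1Dx.
have {}ha := ler_wpM2l t0 ha.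
have {}h1 : (1 - t) * (expR b * (1 - b)) <= (1 - t) * 1.
  by rewrite ler_wpM2l// subr_ge0.
have e : t * (expR b * (1 + (a - b))) + (1 - t) * (expR b * (1 - b)) =
    expR b * (1 + (t * a - b)) by ring.
by move: e; rewrite -/b subrr addr0 !mulr1 in h1 * => e; lra.
Qed.

Lemma qsymbZ (t : R) xi : 0 <= t <= 1 -> qsymb (t *: xi) <= t * qsymb xi.
Proof.
move=> t01; rewrite !qsymbE mulr_sumr; apply: ler_sum => j _; rewrite !mxE.
have := expR_chord _ (xi 0 j) t01; have := expR_chord _ (- xi 0 j) t01.
by rewrite mulrN; lra.
Qed.

(** Each term of q is nonnegative and at least |xi_j| - 1, by e^s >= 1 + s and e^(-s) > 0 for s =
    |xi_j|. *)
Lemma KE_coord_bound (E : R) xi j : KE E xi -> `|xi 0 j| <= `|E| + 1.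
Proof.
rewrite /KE/= qsymbE (bigD1 j)//=.
set s := (X in _ + X).
have s0 : 0 <= s.
  apply: sumr_ge0 => i _.
  by have := expR_ge1Dx (xi 0 i); have := expR_ge1Dx (- xi 0 i); lra.
have := expR_gt0 (xi 0 j); have := expR_gt0 (- xi 0 j).
have := expR_ge1Dx (xi 0 j); have := expR_ge1Dx (- xi 0 j).
by rewrite ler_norml; move=> *; apply/andP; split; lra.
Qed.

Lemma KE0 (E : R) : KE E (0 : 'rV[R]_d).
Proof.
rewrite /KE/= qsymbE big1 ?normr_ge0// => j _.
by rewrite mxE oppr0 expR0; lra.
Qed.

Lemma dotv_le (B : R) (v xi : 'rV[R]_d) : (forall j, `|xi 0 j| <= B) ->
  `|dotv v xi| <= B * \sum_j `|v 0 j|.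
Proof.
move=> xiB; rewrite mulr_sumr; apply: (le_trans (ler_norm_sum _ _ _)).
by apply: ler_sum => j _; rewrite normrM mulrC ler_wpM2r.
Qed.

Lemma coord_le_enorm (v : 'rV[R]_d) j : `|v 0 j| <= enorm v.
Proof.
rewrite -sqrtr_sqr /enorm ler_wsqrtr// /dotv (bigD1 j)//= expr2 lerDl.
by apply: sumr_ge0 => i _; rewrite -expr2 sqr_ge0.
Qed.

(** Boundedness of K^E keeps the [sup] in [rhoE] from being a default value. *)
Lemma rhoE_has_ubound (E : R) (v : 'rV[R]_d) :
  has_ubound [set dotv v xi | xi in KE E].
Proof.
exists ((`|E| + 1) * \sum_j `|v 0 j|) => _ [xi Kxi <-].
apply: le_trans (ler_norm _) _; apply: dotv_le => j.
exact: KE_coord_bound.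
Qed.

Lemma rhoE_ge0 (E : R) (v : 'rV[R]_d) : 0 <= rhoE E v.
Proof.
apply: ub_le_sup; first exact: rhoE_has_ubound.
exists 0; first exact: KE0.
by rewrite /dotv big1// => j _; rewrite mxE mulr0.
Qed.

Lemma sum_step_expR x eta :
  \sum_k expR (- dotv (latv (x + step k)) eta) =
  (2 * d%:R + qsymb eta) * expR (- dotv (latv x) eta).
Proof.
transitivity (\sum_(k : 'I_d * bool)
    expR (- dotv (latv x) eta) * expR (- ((-1) ^+ k.2 * eta 0 k.1))).
  by apply: eq_bigr => k _; rewrite dotv_latvD dotv_latv_step opprD expRD.
rewrite -mulr_sumr mulrC; congr (_ * _).
rewrite -(pair_bigA _ (fun (j : 'I_d) (b : bool) => expR (- ((-1) ^+ b * eta 0 j))))/= qsymbE.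
transitivity (\sum_(j < d) (expR (eta 0 j) + expR (- eta 0 j))).
  by apply: eq_bigr => j _; rewrite big_bool expr1 expr0 mulN1r mul1r opprK.
by rewrite sumrB sumr_const card_ord mulr_natr addrC subrK.
Qed.

(** * Boundedness of u, the limit inferior of V, and complex moduli *)

Lemma l2_bounded (u : 'rV[int]_d -> R[i]) : in_l2 u ->
  exists2 M, 0 <= M & forall x, Normc.normc (u x) <= M.
Proof.
rewrite /in_l2 /summable => usum.
set S := esum _ _ in usum.
have S0 : (0 <= S)%E by apply: esum_ge0 => x _.
have Sfin : S \is a fin_num by rewrite ge0_fin_numE.
(* This choice avoids a square root: 2|u(x)| <= 1 + |u(x)|^2 <= 1 + S. *)
exists (1 + fine S); first by rewrite addr_ge0// fine_ge0.
move=> x; have : ((Normc.normc (u x) ^+ 2)%:E <= S)%E.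
  apply: esum_ge; exists [set x]; first by split => //; exact: finite_set1.
  by rewrite fsbig_set1 lee_fin ler_norm.
rewrite -(fineK Sfin) lee_fin; have := fine_ge0 S0.
by have := sqr_ge0 (Normc.normc (u x) - 1); rewrite sqrrB1; lra.
Qed.

Lemma limf_einf_ge0 (f : 'rV[R]_d -> R) (delta : R) : 0 < delta ->
    (0 <= limf_einf (fun v => (f v)%:E) at_infinity)%E ->
  exists M : R, forall v, M < enorm v -> - delta <= f v.
Proof.
(* [limf_einf] is minus the infimum, over the sets A of the filter, of the supremum of -f on A; some
   A thus has supremum below [delta]. *)
rewrite -lte_fin => delta0; rewrite /limf_einf oppe_ge0.
move=> /le_lt_trans/(_ delta0)/ereal_inf_lt[_ [A [M _ MA] <-] Adelta].
exists M => v Mv.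
have : ((- f v)%:E < delta%:E)%E.
  by apply: le_lt_trans Adelta; apply: ereal_sup_ubound; exists v => //; exact: MA.
by rewrite lte_fin; lra.
Qed.

Lemma normc_real (a : R) : Normc.normc a%:C = `|a|.
Proof. by rewrite /= expr0n addr0 sqrtr_sqr. Qed.

Lemma normc_ge0 (z : R[i]) : 0 <= Normc.normc z.
Proof. by case: z => a b; exact: sqrtr_ge0. Qed.

Lemma normc_sum (K : finType) (F : K -> R[i]) :
  Normc.normc (\sum_k F k) <= \sum_k Normc.normc (F k).
Proof.
elim/big_ind2: _ => [|z a w b za wb|//]; first by rewrite Normc.normc0.
exact: le_trans (le_normcD _ _) (lerD za wb).
Qed.

(* Kato's inequality: V real makes |u| a subsolution. *)
Lemma eigen_normc_sub (V : 'rV[int]_d -> R) (E : R) (u : 'rV[int]_d -> R[i]) x :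
    schrodinger V u x - E%:C * u x = 0 ->
  (2 * d%:R + (V x - E)) * Normc.normc (u x) <=
    \sum_k Normc.normc (u (x + step k)).
Proof.
rewrite /schrodinger sum_neighbours sumrB sumr_const.
have -> : #|{: 'I_d * bool}| = (2 * d)%N.
  by rewrite card_prod card_ord card_bool mulnC.
move=> ux; have {}ux : (2 * d%:R + (V x - E))%:C * u x = \sum_k u (x + step k).
  apply/eqP; rewrite -subr_eq0; apply/eqP; rewrite -[RHS]ux.
  by rewrite -[u x *+ _]mulr_natl natrM !rmorphD rmorphN rmorphM !rmorph_nat; ring.
apply: (le_trans _ (normc_sum _ _)); rewrite -ux Normc.normcM normc_real.
by rewrite ler_wpM2r ?normc_ge0 ?ler_norm.
Qed.


(** Where |u| - A e^(-<x,eta>) is positive the first alternative fails, and the second gives the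
    strictness that the maximum principle asks for. *)
Lemma exponential_comparison (V : 'rV[int]_d -> R) (E : R)
    (u : 'rV[int]_d -> R[i]) (eta : 'rV[R]_d) (c A M : R) :
    (forall x, schrodinger V u x - E%:C * u x = 0) ->
    (forall x, Normc.normc (u x) <= M) -> 0 < c -> 0 <= A ->
    (forall x, Normc.normc (u x) <= A * expR (- dotv (latv x) eta) \/
       qsymb eta + c <= V x - E) ->
  forall x, Normc.normc (u x) <= A * expR (- dotv (latv x) eta).
Proof.
move=> eigen uM c0 A0 alt x; rewrite -subr_le0.
pose phi x := A * expR (- dotv (latv x) eta).
have phi0 y : 0 <= phi y by rewrite mulr_ge0// expR_ge0.
apply: (@bounded_maximum_principle _ _ _ (fun y k => y + step k)
  (fun y => Normc.normc (u y) - phi y) c M) => // {x} x.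
  by rewrite lerBlDr ler_wpDr.
rewrite subr_gt0 => wx.
have {alt} Vx : qsymb eta + c <= V x - E.
  by case: (alt x) => //; rewrite leNgt wx.
have := eigen_normc_sub _ _ _ _ (eigen x).
rewrite sumrB -mulr_sumr sum_step_expR mulrCA -/(phi x).
rewrite card_prod card_ord card_bool natrM [d%:R * _]mulrC.
have := qsymb_ge0 eta; have := phi0 x; have : 0 <= 2 * d%:R :> R by [].
move: (\sum_k _) (phi x) (Normc.normc (u x)) (2 * d%:R) (qsymb eta) (V x - E) wx Vx.
(* S - (D + q) p exceeds (D + c)(n - p) by at least q (n - p) + c p >= 0. *)
by move=> S p n D q W pn qW D0 p0 q0 sub; nra.
Qed.

End Lattice.

Theorem corollary1 (R : realType) (d : nat) (hd : (1 <= d)%N)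
    (V : 'rV[int]_d -> R) (Vt : 'rV[R]_d -> R) (theta : R)
    (hsmooth : smooth Vt)
    (hext : forall x : 'rV[int]_d, Vt (latv x) = V x)
    (htheta : 0 < theta <= 1)
    (hbound : forall a : 'I_d -> nat, exists C : R, forall x : 'rV[R]_d,
       `|mpartial a Vt x|
         <= C * (1 + enorm x) `^ (- (theta * (mlength a)%:R)))
    (hliminf : (0 <= limf_einf (fun x => (Vt x)%:E) at_infinity)%E)
    (E : R) (hE : E < 0)
    (u : 'rV[int]_d -> R[i]) (hu : in_l2 u)
    (heq : forall x : 'rV[int]_d, schrodinger V u x - E%:C * u x = 0) :
  forall eps : R, 0 < eps ->
    exists C : R, 0 < C /\ forall x : 'rV[int]_d,
      Normc.normc (u x) <= C * expR (- ((1 - eps) * rhoE E (latv x))).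
Proof.
move=> eps eps0.
(* [eps] may exceed 1, while convexity needs t in [0, 1]. Since rho_E >= 0, decay at rate t implies
   decay at rate 1 - eps. *)
pose t := Num.max (1 - eps) 0.
have t0 : 0 <= t by rewrite le_max lexx orbT.
have t1 : t < 1 by rewrite gt_max ltr01 andbT; lra.
have epst : 1 - eps <= t by rewrite le_max lexx.
have [U U0 uU] := l2_bounded _ hu.
(* Half of the gap |E| - t|E|: one half absorbs V >= -c far away, the other is the strictness left
   for the comparison. *)
pose c := (1 - t) * - E / 2.
have c0 : 0 < c by rewrite divr_gt0// mulr_gt0; lra.
have [M VM] := limf_einf_ge0 _ _ c0 hliminf.
(* [B] bounds |<x,xi>| for xi in K^E and |x| <= M, so with this [A] the exponential majorant is at
   least U + 1 on the ball, uniformly in xi. *)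
pose B := (`|E| + 1) * \sum_(j < d) `|M|.
pose A := (U + 1) * expR B.
have A0 : 0 < A by rewrite mulr_gt0 ?expR_gt0//; lra.
have uA x xi : KE E xi ->
    Normc.normc (u x) <= A * expR (- (t * dotv (latv x) xi)).
  move=> Kxi; rewrite -dotvZr; move: x.
  apply: (exponential_comparison _ _ _ _ _ _ _ heq uU c0 (ltW A0)) => x.
  have [Mx|Mx] := ltP M (enorm (latv x : 'rV[R]_d)).
    right; have t01 : 0 <= t <= 1 by rewrite t0 ltW.
    have := qsymbZ _ xi t01; have := ler_wpM2l t0 Kxi.
    have := VM _ Mx; rewrite hext ltr0_norm// /c; lra.
  left; rewrite /A -mulrA -expRD.
  have dB : `|dotv (latv x) xi| <= B.
    apply: (le_trans (dotv_le _ _ _ (fun j => KE_coord_bound _ _ j Kxi))).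
    rewrite ler_wpM2l ?addr_ge0//; apply: ler_sum => j _.
    exact: le_trans (coord_le_enorm _ _) (le_trans Mx (ler_norm _)).
  have B0 : 0 <= B := le_trans (normr_ge0 _) dB.
  apply: (le_trans (uU x)); apply: (@le_trans _ _ (U + 1)); first lra.
  rewrite ler_peMr ?addr_ge0// -[leLHS]expR0 ler_expR dotvZr subr_ge0.
  by have := ler_norm (dotv (latv x) xi); nra.
exists A; split => // x.
have rho0 := rhoE_ge0 E (latv x : 'rV[R]_d).
apply: (@le_trans _ _ (A * expR (- (t * rhoE E (latv x))))); last first.
  by rewrite ler_pM2l// ler_expR lerN2 ler_wpM2r.
have [u0|u0] := leP (Normc.normc (u x)) 0.
  by apply: (le_trans u0); rewrite mulr_ge0 ?expR_ge0 ?ltW.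
(* Logarithms, legitimate as u(x) is nonzero here, turn the family of exponential bounds into one
   upper bound valid for all xi, which can pass to the supremum. *)
have uAL xi : KE E xi -> t * dotv (latv x) xi <= - ln (Normc.normc (u x) / A).
  move=> Kxi; rewrite lerNr -ler_expR lnK ?posrE ?divr_gt0//.
  by rewrite ler_pdivrMr// mulrC uA.
suff trho : t * rhoE E (latv x) <= - ln (Normc.normc (u x) / A).
  move: trho; rewrite lerNr -ler_expR lnK ?posrE ?divr_gt0//.
  by rewrite ler_pdivrMr// mulrC.
(* Passing to the supremum divides by t; for t = 0 the instance xi = 0 already suffices. *)
have [t_eq0|t_neq0] := eqVneq t 0.
  by have := uAL _ (KE0 E); rewrite t_eq0 !mul0r.
have t_gt0 : 0 < t by rewrite lt_neqAle eq_sym t_neq0.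
rewrite mulrC -ler_pdivlMr//; apply: ge_sup.
  by exists (dotv (latv x) 0), 0 => //; exact: KE0.
by move=> _ [xi Kxi <-]; rewrite ler_pdivlMr// mulrC uAL.
Qed.
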